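(* Let $\Sigma$ be a finite alphabet and let $\mathbf{a} = (a(n))_{n \in \mathbb{Z}}$ be a two-sided bracket word over $\Sigma$. Let $f \colon \mathbb{R}_+ \to \mathbb{R}$ be a Hardy field function with polynomial growth (take a representative of its germ defined on $[0,\infty)$). Let $p(H)$ denote the number of distinct words $w \in \Sigma^H$ of the form $(a(\lfloor f(N)\rfloor), a(\lfloor f(N+1)\rfloor),\dots,a(\lfloor f(N+H-1)\rfloor))$ with $N \in \mathbb{N}_0$ (the subword complexity of $(a(\lfloor f(n)\rfloor))_{n=0}^\infty$). Then there exist $0<\delta<1$ and $C>0$ such that $p(H) \le \exp(C H^{\delta})$ for all $H \in \mathbb{N}$.
   Context: A generalised polynomial (gp) map $\mathbb{R}^d \to \mathbb{R}$ is an element of the smallest family of maps containing all polynomial maps and closed under pointwise addition, pointwise multiplication and taking the integer part $\lfloor\cdot\rfloor$ pointwise; a gp map $\mathbb{Z}\to\mathbb{R}$ is the restriction to $\mathbb{Z}$ of a gp map $\mathbb{R}\to\mathbb{R}$. A (two-sided) bracket word over a finite alphabet $\Sigma$ is a sequence $a\colon\mathbb{Z}\to\Sigma$ of the form $a = \pi\circ g$, where $g\colon \mathbb{Z}\to\mathbb{R}$ is a finitely-valued gp map and $\pi$ is a map from the (finite) range of $g$ to $\Sigma$ (a letter-to-letter coding). A Hardy field is a subfield of the ring of germs at $+\infty$ of real-valued functions defined on half-lines $(c,\infty)$, closed under differentiation; a Hardy field function is an element of some Hardy field. Such $f$ has polynomial growth if $f(t)/t^n \to 0$ as $t\to\infty$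 for some $n\in\mathbb{N}$. *)

(* Defs.v *)
From HB Require Import structures.
From mathcomp Require Import all_boot all_order all_algebra.
From mathcomp Require Import all_classical all_reals all_analysis.
Set Implicit Arguments. Unset Strict Implicit. Unset Printing Implicit Defensive.
Import Order.TTheory GRing.Theory Num.Theory.
Import numFieldNormedType.Exports.
Local Open Scope classical_set_scope.
Local Open Scope ring_scope.

Definition fl {R : realType} (x : R) : R := (Num.floor x)%:~R.

Inductive gp {R : realType} : (R -> R) -> Prop :=
| gp_poly (p : {poly R}) : gp (fun x => p.[x])
| gp_add (f g : R -> R) : gp f -> gp g -> gp (fun x => f x + g x)
| gp_mul (f g : R -> R) : gp f -> gp g -> gp (fun x => f x * g x)
| gp_floor (f : R -> R) : gp f -> gp (fun x => fl (f x)).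

Definition bracket_word {R : realType} (Sigma : finType) (a : int -> Sigma) : Prop :=
  exists g : R -> R, gp g /\
    finite_set (range (fun n : int => g n%:~R)) /\
    exists pi : R -> Sigma, forall n : int, a n = pi (g n%:~R).

(* Germs at +oo are represented by total functions R -> R; two functions
   represent the same germ when they agree eventually. *)
Definition ev_eq {R : realType} (f g : R -> R) : Prop :=
  \forall x \near +oo%R, f x = g x.

(* A Hardy field: a set of germs (saturated under eventual equality) which is
   a subfield of the ring of germs and is closed under differentiation. *)
Definition hardy_field {R : realType} (H : set (R -> R)) : Prop :=
  [/\ (forall f g, H f -> ev_eq f g -> H g),
      H (fun _ => 0), H (fun _ => 1) &
      (forall f g, H f -> H g -> H (fun x => f x + g x))] /\
  [/\
      (forall f, H f -> H (fun x => - f x)),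
      (forall f g, H f -> H g -> H (fun x => f x * g x)),
      (forall f, H f -> ~ ev_eq f (fun _ => 0) ->
          exists g, H g /\ ev_eq (fun x => f x * g x) (fun _ => 1)) &
      (forall f, H f -> exists g, H g /\
          \forall x \near +oo%R, is_derive (x : R) (1 : R) f (g x))].

Definition hardy_function {R : realType} (f : R -> R) : Prop :=
  exists H : set (R -> R), hardy_field H /\ H f.

Definition poly_growth {R : realType} (f : R -> R) : Prop :=
  exists n : nat, (fun t : R => f t / t ^+ n) x @[x --> +oo%R] --> (0 : R).

Definition subword_complexity {R : realType} (Sigma : finType)
    (a : int -> Sigma) (f : R -> R) (H : nat) : nat :=
  #| [set w : {ffun 'I_H -> Sigma} |
       `[< exists N : nat, forall i : 'I_H,
             w i = a (Num.floor (f (N + i)%:R)) >] ] |.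

(* Main.v *)
(* The subword complexity even grows polynomially in H.

   Fix H and put s(h) = f(N + h). Some iterated difference of order m of f has
   eventually constant sign and is O(1 / n), because the derivatives of f are
   eventually monotone; so for N at least a large power of H, Newton
   interpolation gives a real polynomial P of degree < m extremely close to s on
   [0, H). The floors of s and P differ only at points where P is close to an
   integer. If there are at least m such points, Lagrange interpolation through
   them makes P close to a polynomial Q with rational values of denominator at
   most a power of H, so that floor(s) is read off from Q and from the sign of
   s - Q, which changes at most m times because the difference of order m of
   s - Q has constant sign. In both cases the word is a mixture, with boundedly
   many switches, of two words a(floor(P1(h))) and a(floor(P2(h))) with P1 and P2
   polynomials of degree < m.

   To count the latter words, rewrite g(floor(P(h))), for g a generalised
   polynomial, as a linear combination of polynomially bounded integer
   sequences u_j(h): in each floor, the integer part of a coefficient of u_j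
   comes out, so only coefficients in [0, 1) remain under the floor, and counting
   cells of a hyperplane arrangement leaves polynomially many possibilities for
   the sequences. The real coefficients of the final combination only matter
   modulo the number of values of g. *)

Require Import Defs.
From HB Require Import structures.
From mathcomp Require Import all_boot all_order all_algebra.
From mathcomp Require Import all_classical all_reals all_analysis.
From mathcomp Require Import zify ring lra.
Import Order.TTheory GRing.Theory Num.Theory.
Import numFieldNormedType.Exports.
Local Open Scope ring_scope.

(** * Coverings and hyperplane arrangements *)

(** A cardinality bound that makes sense for undecidable predicates on infinite types; the list may
    also contain elements outside [A]. *)
Definition covered {T : eqType} (n : nat) (A : T -> Prop) : Prop :=
  exists s : seq T, (size s <= n)%N /\ forall x, A x -> x \in s.

Lemma covered_weaken {T : eqType} {n : nat} {A : T -> Prop} (m : nat)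
    (B : T -> Prop) :
  covered n A -> (n <= m)%N -> (forall x, B x -> A x) -> covered m B.
Proof.
move=> [s [sn sA]] nm BA; exists s; split; first exact: leq_trans nm.
by move=> x /BA /sA.
Qed.

Lemma covered_subsingleton {T : eqType} (A : T -> Prop) :
  (forall x y, A x -> A y -> x = y) -> covered 1 A.
Proof.
move=> Auniq; have [[x Ax]|noA] := pselect (exists x, A x).
  by exists [:: x]; split=> // y Ay; rewrite inE (Auniq y x).
by exists [::]; split=> // x Ax; case: noA; exists x.
Qed.

Lemma covered_dep {T U : eqType} {n k : nat} {A : T -> Prop}
    (B : T -> U -> Prop) :
  covered n A -> (forall x, A x -> covered k (B x)) ->
  covered (n * k) (fun y => exists x, A x /\ B x y).
Proof.
move=> [s [sn sA]] AB.
have {}AB x : {t : seq U | (size t <= k)%N & A x -> forall y, B x y -> y \in t}.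
  apply: cid2; have [/AB[t [tk tB]]|nA] := pselect (A x).
    by exists t.
  by exists [::].
pose t x := s2val (AB x).
exists (flatten [seq t x | x <- s]); split.
  rewrite size_flatten /shape -map_comp.
  apply: (@leq_trans (size s * k)%N); last by rewrite leq_mul2r sn orbT.
  elim: (s) => //= x s' IH; rewrite mulSn leq_add //.
  by rewrite /t; case: (AB x).
move=> y [x [Ax Bxy]]; apply/flatten_mapP; exists x; first exact: sA.
by rewrite /t; case: (AB x) => /= ? _; apply.
Qed.

Lemma covered_image {T U : eqType} {n : nat} {A : T -> Prop} (f : T -> U)
    (B : U -> Prop) :
  covered n A -> (forall y, B y -> exists2 x, A x & y = f x) -> covered n B.
Proof.
move=> [s [sn sA]] BA; exists (map f s); split; first by rewrite size_map.
by move=> y /BA[x /sA xs ->]; apply: map_f.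
Qed.

Lemma covered_pair {T U : eqType} {n k : nat} {A : T -> Prop} {B : U -> Prop} :
  covered n A -> covered k B ->
  covered (n * k) (fun z : T * U => A z.1 /\ B z.2).
Proof.
move=> cA cB.
have := @covered_dep T (T * U)%type n k A
  (fun x z => B z.2 /\ z.1 = x) cA.
case=> [x _|s [sn sP]].
  by apply: (covered_image (pair x) _ cB) => -[u v] /= [Bv ->]; exists v.
exists s; split=> // -[x y] [/= Ax By]; apply: sP.
by exists x; split.
Qed.

Lemma coveredU {T : eqType} {n k : nat} {A B : T -> Prop} :
  covered n A -> covered k B -> covered (n + k) (fun x => A x \/ B x).
Proof.
move=> [s [sn sA]] [t [tk tB]]; exists (s ++ t); split.
  by rewrite size_cat leq_add.
by move=> x [/sA|/tB]; rewrite mem_cat => ->; rewrite ?orbT.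
Qed.

Lemma covered_ltn (n : nat) : covered n (fun k => (k < n)%N).
Proof.
exists (iota 0 n); rewrite size_iota; split=> // k kn.
by rewrite mem_iota.
Qed.

Lemma covered_finType (T : finType) (A : T -> Prop) : covered #|T| A.
Proof. by exists (enum T); rewrite cardE; split=> // x _; rewrite mem_enum. Qed.

Definition aff {R : realType} {r : nat} (L : ('I_r -> R) * R)
    (x : 'I_r -> R) : R := \sum_i L.1 i * x i + L.2.

(** The cell of [x] in a hyperplane arrangement; points on a hyperplane count as nonnegative. *)
Definition signs {R : realType} {r : nat} (s : seq (('I_r -> R) * R))
    (x : 'I_r -> R) : seq bool := [seq 0 <= aff L x | L <- s].

Lemma leq_expn2r (m n r : nat) : (m <= n)%N -> (m ^ r <= n ^ r)%N.
Proof. by case: r => // r mn; rewrite leq_exp2r. Qed.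

(** Cells are convex, so the point where the segment from [x] to [y] crosses the hyperplane of [L]
    stays in their common cell. *)
Lemma signs_segment {R : realType} {r : nat} (L : ('I_r -> R) * R)
    (s : seq (('I_r -> R) * R)) (x y : 'I_r -> R) :
  0 <= aff L x -> aff L y < 0 -> signs s x = signs s y ->
  exists z, aff L z = 0 /\ signs s z = signs s x.
Proof.
move=> Lx Ly sxy.
pose t := aff L x / (aff L x - aff L y).
have d0 : 0 < aff L x - aff L y by rewrite subr_gt0 (lt_le_trans Ly).
have t0 : 0 <= t by rewrite divr_ge0 // ltW.
have t1 : 0 <= 1 - t.
  by rewrite subr_ge0 /t ler_pdivrMr // mul1r lerDl oppr_ge0 ltW.
have affz M : aff M (fun i => (1 - t) * x i + t * y i)
    = (1 - t) * aff M x + t * aff M y.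
  rewrite /aff !mulrDr !mulr_sumr addrACA -big_split /= -mulrDl subrK mul1r.
  by congr (_ + _); apply: eq_bigr => i _; ring.
exists (fun i => (1 - t) * x i + t * y i); split.
  rewrite affz /t; field; exact: lt0r_neq0.
move: sxy; rewrite /signs; elim: s => //= M s IH [Mxy /IH ->].
congr (_ :: _); rewrite affz; case: (lerP 0 (aff M x)) Mxy => Mx My.
  by rewrite addr_ge0 // mulr_ge0 // -My.
apply/negbTE; rewrite -ltNge; have {}My : aff M y < 0 by rewrite ltNge -My.
have [t_eq0|tn0] := eqVneq t 0.
  by rewrite t_eq0 subr0 mul1r mul0r addr0.
rewrite -(addr0 0) ler_ltD //; first by rewrite mulr_ge0_le0 // ltW.
by rewrite pmulr_rlt0 // lt_neqAle eq_sym tn0.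
Qed.

(** Solving [aff L z = 0] for coordinate [k] and substituting turns the other forms into affine
    forms in one variable fewer. *)
Lemma hyperplane_param {R : realType} {r : nat} (L : ('I_r.+1 -> R) * R)
    (k : 'I_r.+1) (s : seq (('I_r.+1 -> R) * R)) : L.1 k != 0 ->
  exists s' : seq (('I_r -> R) * R), size s' = size s /\
    forall z, aff L z = 0 -> exists y, signs s z = signs s' y.
Proof.
move=> Lk.
pose restr (M : ('I_r.+1 -> R) * R) : ('I_r -> R) * R :=
  (fun j => M.1 (lift k j) - M.1 k * L.1 (lift k j) / L.1 k,
   M.2 - M.1 k * L.2 / L.1 k).
exists (map restr s); split; first by rewrite size_map.
move=> z Lz; exists (fun j => z (lift k j)).
rewrite /signs -map_comp; apply: eq_map => M /=; congr (0 <= _).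
move: Lz; rewrite /aff /= !(bigD1_ord k) //=.
set SL := (\sum_(i < r) _) => Lz.
have -> : \sum_(i < r) (M.1 (lift k i) - M.1 k * L.1 (lift k i) / L.1 k)
    * z (lift k i) = \sum_(i < r) M.1 (lift k i) * z (lift k i)
      - M.1 k / L.1 k * SL.
  by rewrite /SL mulr_sumr -sumrB; apply: eq_bigr => i _; ring.
have -> : z k = - (SL + L.2) / L.1 k.
  apply: (mulfI Lk); rewrite mulrCA mulfV // mulr1.
  by apply/eqP; rewrite -subr_eq0 opprK addrA Lz.
by field.
Qed.

(* A new hyperplane cuts a cell in two only if it meets it, and it meets as
   many cells as its trace on the other hyperplanes has cells. *)
Lemma covered_signs {R : realType} {r : nat} (s : seq (('I_r -> R) * R)) :
  covered ((size s).+1 ^ r) (fun bs => exists x, bs = signs s x).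
Proof.
move: {2}(size s) (erefl (size s)) => n.
elim: n r s => [|n IH] r [|L s] //.
  move=> _; have : covered 1 (fun bs => exists x, bs = @signs R r [::] x).
    by apply: covered_subsingleton => x y [? ->] [? ->].
  by move=> /covered_weaken; apply; rewrite // exp1n.
move=> [szs]; have cs := IH r s szs.
have [[k Lk]|L0] := pselect (exists k, L.1 k != 0); last first.
  have /covered_weaken : covered ((size s).+1 ^ r)
      (fun bs => exists x, bs = signs (L :: s) x).
    apply: (covered_image (cons (0 <= L.2)) _ cs) => _ [x ->].
    exists (signs s x); first by exists x.
    rewrite /signs /= /aff big1 ?add0r // => i _.
    have [->|Li] := eqVneq (L.1 i) 0; first by rewrite mul0r.
    by case: L0; exists i.
  by apply=> //; apply: leq_expn2r.
case: r L s szs cs k Lk => [|r] L s szs cs k Lk; first by case: (k).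
have [s' [szs' Ls']] := hyperplane_param L k s Lk.
(* The cells of [s] that [L] cuts in two. Below, each cell of [s] is listed once, with sign true if
   it reaches the nonnegative side, and those in [D] are listed again with sign false. *)
pose D bs := exists x y, [/\ 0 <= aff L x, aff L y < 0, bs = signs s x
  & bs = signs s y].
have cD : covered ((size s).+1 ^ r) D.
  have /covered_weaken := IH r s' (etrans szs' szs); rewrite szs'.
  apply=> //.
  move=> bs [x [y [Lx Ly -> sxy]]].
  have [z [Lz <-]] := signs_segment L s x y Lx Ly sxy.
  exact: Ls'.
pose up bs := `[< exists x, 0 <= aff L x /\ bs = signs s x >].
have cA := covered_image (fun bs => up bs :: bs)
  (fun bs => exists2 bs', (exists x, bs' = signs s x) & bs = up bs' :: bs') cs
  (fun bs P => P).
have cB := covered_image (cons false) (fun bs => exists2 bs', D bs' &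
  bs = false :: bs') cD (fun bs P => P).
apply: (covered_weaken _ _ (coveredU cA cB)).
  (* With n the size of [s]: (n+1)^(r+1) + (n+1)^r = (n+2) (n+1)^r. *)
  by rewrite !expnS -mulSnr leq_mul // leq_expn2r.
move=> _ [x ->]; rewrite /signs /= -/(signs s x).
case: (lerP 0 (aff L x)) => Lx.
  left; exists (signs s x); first by exists x.
  by congr (_ :: _); apply/esym/asboolP; exists x.
have [[y [Ly sxy]]|nup] := pselect (exists y, 0 <= aff L y /\ signs s x = signs s y).
  by right; exists (signs s x) => //; exists y, x.
left; exists (signs s x); first by exists x.
by congr (_ :: _); apply/esym/negbTE/asboolP.
Qed.

(** The sums lie in [-E, E] with [E] = #|J| M B, so their floors are determined by the cell of [c]
    for the H (2E+1) affine forms that compare a sum with an integer of this range. *)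
Lemma covered_floor_sum {R : realType} (J : finType) (H B M : nat)
    (u : {ffun J * 'I_H -> int}) : (forall z, `|u z| <= B)%N ->
  covered ((H * (#|J| * (M * B)).*2.+1).+1 ^ #|J|)
    (fun v : {ffun 'I_H -> int} => exists2 c : J -> R,
       forall j, 0 <= c j <= M%:R &
       forall h, v h = Num.floor (\sum_j c j * (u (j, h))%:~R)).
Proof.
move=> uB; pose E := (#|J| * (M * B))%N.
pose L (z : 'I_H * nat) : ('I_#|J| -> R) * R :=
  (fun i => (u (enum_val i, z.1))%:~R, E%:R - z.2%:R).
pose s := [seq L z | z <- allpairs pair (enum 'I_H) (iota 0 E.*2.+1)].
have szs : size s = (H * E.*2.+1)%N.
  by rewrite size_map size_allpairs size_iota -cardE card_ord.
have := @covered_signs R _ s; rewrite szs => cs.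
rewrite -(muln1 (_ ^ _)%N).
pose Q (bs : seq bool) (v : {ffun 'I_H -> int}) := exists c : J -> R,
  [/\ forall j, 0 <= c j <= M%:R,
   forall h, v h = Num.floor (\sum_j c j * (u (j, h))%:~R)
   & bs = signs s (fun i => c (enum_val i))].
apply: (covered_weaken _ _ (covered_dep Q cs _)) => //; last first.
  move=> v [c c01 vE]; exists (signs s (fun i => c (enum_val i))).
  by split; [exists (fun i => c (enum_val i))|exists c].
move=> bs _; apply: covered_subsingleton.
have affE (c : J -> R) h k : aff (L (h, k)) (fun i => c (enum_val i)) =
    \sum_j c j * (u (j, h))%:~R + (E%:R - k%:R).
  rewrite /aff /=; congr (_ + _).
  rewrite [RHS](reindex (@enum_val J predT)) /=; last first.
    by apply: onW_bij; apply: enum_val_bij.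
  by apply: eq_bigr => i _; rewrite mulrC.
suff le_floor_pattern (c d : J -> R) h : (forall j, 0 <= c j <= M%:R) ->
    signs s (fun i => c (enum_val i)) = signs s (fun i => d (enum_val i)) ->
    Num.floor (\sum_j c j * (u (j, h))%:~R) <=
    Num.floor (\sum_j d j * (u (j, h))%:~R).
  move=> v w [c [c01 vE cE]] [d [d01 wE dE]]; apply/ffunP => h.
  rewrite vE wE; apply/eqP; rewrite eq_le !le_floor_pattern //.
    by rewrite -cE -dE.
  by rewrite -cE.
move=> c01 cd.
set y := \sum_j _; set y' := \sum_j _.
have yE : `|y| <= E%:R.
  apply: (le_trans (ler_norm_sum _ _ _)).
  apply: (@le_trans _ _ (\sum_(j : J) (M * B)%:R)).
    apply: ler_sum => j _; rewrite normrM natrM ler_pM //.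
      by case/andP: (c01 j) => c0 cM; rewrite ger0_norm.
    by rewrite -intr_norm -abszE ler_nat.
  by rewrite sumr_const -mulrnA mulnC.
have fE : (- E%:Z <= Num.floor y <= E%:Z).
  rewrite floor_ge_int -ltzD1 floor_lt_int mulrNz.
  move: yE; rewrite ler_norml => /andP[-> yE] /=.
  by rewrite (le_lt_trans yE) // intrD ltrDl.
(* The form with this index compares a sum with the floor of [y]: it is nonnegative at [c], hence
   also at [d]. *)
pose k := absz (Num.floor y + E%:Z).
have kE : (k%:Z = Num.floor y + E%:Z) by rewrite /k; lia.
have km : (k < E.*2.+1)%N by lia.
have Lin : L (h, k) \in s.
  apply/map_f/allpairsP; exists (h, k); rewrite mem_enum mem_iota.
  by split.
have : (0 <= aff (L (h, k)) (fun i => c (enum_val i))) =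
  (0 <= aff (L (h, k)) (fun i => d (enum_val i))).
  move: cd Lin; rewrite /signs => /eq_in_map; exact.
have kR : (k%:R : R) = (Num.floor y)%:~R + E%:R.
  by rewrite [LHS]pmulrn kE intrD.
rewrite !affE -/y -/y' kR.
have -> : y + (E%:R - ((Num.floor y)%:~R + E%:R)) = y - (Num.floor y)%:~R by ring.
have -> : y' + (E%:R - ((Num.floor y)%:~R + E%:R)) = y' - (Num.floor y)%:~R by ring.
by rewrite !subr_ge0 floor_le floor_ge_int => <-.
Qed.

(** * Generalised polynomials along polynomials *)

(** The base [H.+2] is at least 2 even for [H = 0], so constants can be absorbed into the
    exponent. *)
Lemma leq_pow_self (H n : nat) : (n <= H.+2 ^ n)%N.
Proof. by rewrite ltnW // ltn_expl. Qed.

(* The sequences h |-> F x h (x in X) are linear combinations, with completely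
   arbitrary real coefficients, of integer sequences whose values are
   polynomially bounded and which on [0, H) come in polynomially many
   patterns. *)
Definition expandable {R : realType} {X : Type} (F : X -> nat -> R) : Prop :=
  exists (J : finType) (K : nat) (A : forall H, {ffun J * 'I_H -> int} -> Prop),
  [/\ forall H, covered (H.+2 ^ K) (A H),
      forall H u, A H u -> forall z, (`|u z| <= H.+2 ^ K)%N
    & forall H x, exists2 u, A H u &
        exists c : J -> R, forall h : 'I_H,
          F x h = \sum_j c j * (u (j, h))%:~R].

Lemma expandable_linear {R : realType} {X : Type} (F : X -> nat -> R)
    (m K : nat) (c : X -> 'I_m -> R) (w : 'I_m -> nat -> int) :
  (forall i h, (`|w i h| <= h.+2 ^ K)%N) ->
  (forall x h, F x h = \sum_i c x i * (w i h)%:~R) -> expandable F.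
Proof.
move=> wK FE; exists 'I_m, K.
exists (fun H (u : {ffun 'I_m * 'I_H -> int}) =>
  u = [ffun z : 'I_m * 'I_H => w z.1 z.2]); split.
- move=> H; set A := (A in covered _ A).
  have /covered_weaken : covered 1 A by apply: covered_subsingleton => x y -> ->.
  by apply; rewrite ?expn_gt0.
- move=> H _ -> z; rewrite ffunE; apply: leq_trans (wK _ _) _.
  by apply: leq_expn2r; rewrite !ltnS ltnW.
- move=> H x; eexists; first by [].
  by exists (c x) => h; rewrite FE; apply: eq_bigr => i _; rewrite ffunE.
Qed.

Lemma expandable_ext {R : realType} {X : Type} (F G : X -> nat -> R) :
  (forall x h, F x h = G x h) -> expandable F -> expandable G.
Proof.
by move=> FG; congr expandable; apply/funext => x; apply/funext => h.
Qed.

Lemma expandable_cst {R : realType} {X : Type} (c : X -> R) :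
  expandable (fun x _ => c x).
Proof.
apply: (@expandable_linear _ _ _ 1 0 (fun x _ => c x) (fun _ _ => 1)) => //.
by move=> x h; rewrite big_ord1 mulr1.
Qed.

Lemma expandable_add {R : realType} {X : Type} {F G : X -> nat -> R} :
  expandable F -> expandable G -> expandable (fun x h => F x h + G x h).
Proof.
move=> [J1 [K1 [A1 [c1 b1 e1]]]] [J2 [K2 [A2 [c2 b2 e2]]]].
pose mk H (u : {ffun J1 * 'I_H -> int} * {ffun J2 * 'I_H -> int}) :
  {ffun (J1 + J2) * 'I_H -> int} :=
  [ffun z => match z.1 with inl j => u.1 (j, z.2) | inr j => u.2 (j, z.2) end].
exists (J1 + J2)%type, (K1 + K2)%N.
exists (fun H u => exists2 u', A1 H u'.1 /\ A2 H u'.2 & u = mk H u'); split.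
- move=> H; rewrite expnD.
  by apply: (covered_image (mk H) _ (covered_pair (c1 H) (c2 H))).
- move=> H _ [u' [Au1 Au2] ->] z; rewrite ffunE.
  case: z.1 => j; [apply: leq_trans (b1 _ _ Au1 _) _
                  |apply: leq_trans (b2 _ _ Au2 _) _];
    by rewrite leq_pexp2l // ?leq_addr ?leq_addl.
- move=> H x; have [u1 Au1 [k1 E1]] := e1 H x; have [u2 Au2 [k2 E2]] := e2 H x.
  exists (mk H (u1, u2)); first by exists (u1, u2).
  exists (fun j => match j with inl j => k1 j | inr j => k2 j end) => h.
  rewrite big_sumType /= E1 E2.
  by congr (_ + _); apply: eq_bigr => j _; rewrite ffunE.
Qed.

Lemma expandable_mul {R : realType} {X : Type} {F G : X -> nat -> R} :
  expandable F -> expandable G -> expandable (fun x h => F x h * G x h).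
Proof.
move=> [J1 [K1 [A1 [c1 b1 e1]]]] [J2 [K2 [A2 [c2 b2 e2]]]].
pose mk H (u : {ffun J1 * 'I_H -> int} * {ffun J2 * 'I_H -> int}) :
  {ffun (J1 * J2) * 'I_H -> int} :=
  [ffun z => u.1 (z.1.1, z.2) * u.2 (z.1.2, z.2)].
exists (J1 * J2)%type, (K1 + K2)%N.
exists (fun H u => exists2 u', A1 H u'.1 /\ A2 H u'.2 & u = mk H u'); split.
- move=> H; rewrite expnD.
  by apply: (covered_image (mk H) _ (covered_pair (c1 H) (c2 H))).
- move=> H _ [u' [Au1 Au2] ->] z; rewrite ffunE abszM expnD.
  by rewrite leq_mul ?b1 ?b2.
- move=> H x; have [u1 Au1 [k1 E1]] := e1 H x; have [u2 Au2 [k2 E2]] := e2 H x.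
  exists (mk H (u1, u2)); first by exists (u1, u2).
  exists (fun j => k1 j.1 * k2 j.2) => h.
  rewrite E1 E2 big_distrlr pair_bigA /=.
  by apply: eq_bigr => j _; rewrite ffunE intrM mulrACA.
Qed.

(* Splitting c = floor c + {c} in each coefficient, the floor of the sum of
   the c_j u_j is the sum of the (floor c_j) u_j plus the single new integer
   sequence floor (sum {c_j} u_j). *)
Lemma expandable_fl {R : realType} {X : Type} {F : X -> nat -> R} :
  expandable F -> expandable (fun x h => fl (F x h)).
Proof.
move=> [J [K [A [cA bA eA]]]].
pose mk H (u : {ffun J * 'I_H -> int} * {ffun 'I_H -> int}) :
  {ffun (option J) * 'I_H -> int} :=
  [ffun z => if z.1 is Some j then u.1 (j, z.2) else u.2 z.2].
pose Q H (u : {ffun J * 'I_H -> int}) (v : {ffun 'I_H -> int}) :=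
  exists2 c : J -> R, forall j, 0 <= c j <= 1%N%:R &
    forall h, v h = Num.floor (\sum_j c j * (u (j, h))%:~R).
(* The three terms pay for the patterns [u], for the new floors, and for the factor #|J| in the size
   of the new sequence. *)
pose K' := (K + (#|J|.*2.+2 + K + 1) * #|J| + #|J|)%N.
exists (option J), K'.
exists (fun H u => exists2 u', A H u'.1 /\ Q H u'.1 u'.2 & u = mk H u'); split.
- move=> H.
  have cQ u : A H u ->
      covered (H.+2 ^ ((#|J|.*2.+2 + K + 1) * #|J|)) (fun u' => u'.1 = u /\ Q H u u'.2).
    move=> Au; have cQ := @covered_floor_sum R J H _ 1 u (bA H u Au).
    have {}cQ := covered_image (pair u) (fun u' => u'.1 = u /\ Q H u u'.2) cQ.
    apply: (covered_weaken _ _ (cQ _)) => // [[u1 v] /= [-> Qv]|].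
      by exists v.
    rewrite expnM leq_expn2r // mul1n.
    rewrite !expnD expn1.
    have P1 : (0 < H.+2 ^ K)%N by rewrite expn_gt0.
    have P2 := leq_pow_self H (#|J|.*2.+2).
    apply: (@leq_trans (#|J|.*2.+2 * H.+2 ^ K * H.+2)); last by rewrite !leq_mul.
    move: (H.+2 ^ K)%N P1 => a P1.
    have -> : ((H * (#|J| * a).*2.+1).+1 = #|J|.*2 * a * H + H + 1)%N by lia.
    have -> : (#|J|.*2.+2 * a * H.+2 = #|J|.*2 * a * H + 2 * (a * H) +
      (#|J|.*2 * a + a * 2).*2)%N by lia.
    have : (H <= a * H)%N by rewrite leq_pmull.
    by lia.
  have cI := covered_image (mk H) (fun u => exists2 u',
    A H u'.1 /\ Q H u'.1 u'.2 & u = mk H u') (covered_dep _ (cA H) cQ).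
  apply: (covered_weaken _ _ (cI _)) => //; last first.
    by rewrite -expnD leq_pexp2l // leq_addr.
  by move=> _ [[u v] [/= Au Qu] ->]; exists (u, v) => //; exists u.
- move=> H _ [[u v] [/= Au [c c01 vE]] ->] [[j|] h]; rewrite ffunE /=.
    by apply: leq_trans (bA _ _ Au _) _; rewrite leq_pexp2l // /K' -addnA leq_addr.
  have sumE : `|\sum_j c j * (u (j, h))%:~R| <= (#|J| * H.+2 ^ K)%:R :> R.
    apply: (le_trans (ler_norm_sum _ _ _)).
    apply: (@le_trans _ _ (\sum_(j : J) (H.+2 ^ K)%:R)).
      apply: ler_sum => j _; rewrite normrM -[leRHS]mul1r ler_pM //.
        by case/andP: (c01 j) => c0 cM; rewrite ger0_norm.
      by rewrite -intr_norm -abszE ler_nat bA.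
    by rewrite sumr_const -mulrnA mulnC.
  have fE : (- (#|J| * H.+2 ^ K)%:Z <= v h <= (#|J| * H.+2 ^ K)%:Z).
    rewrite vE floor_ge_int -ltzD1 floor_lt_int mulrNz.
    move: sumE; rewrite ler_norml => /andP[-> yE] /=.
    by rewrite (le_lt_trans yE) // intrD ltrDl.
  apply: (@leq_trans (#|J| * H.+2 ^ K)%N); first by lia.
  rewrite /K' mulnC addnAC expnD -[leqLHS]muln1 leq_mul ?expn_gt0 //.
  by rewrite expnD leq_mul // leq_pow_self.
- move=> H x; have [u Au [c E]] := eA H x.
  pose c' j := c j - (Num.floor (c j))%:~R.
  pose v : {ffun 'I_H -> int} :=
    [ffun h => Num.floor (\sum_j c' j * (u (j, h))%:~R)].
  exists (mk H (u, v)).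
    exists (u, v) => //; split => //; exists c' => [j|h]; last by rewrite ffunE.
    rewrite subr_ge0 floor_le lerBlDr addrC ltW //.
    by have := floorD1_gt (c j); rewrite intrD.
  exists (fun j => if j is Some j then (Num.floor (c j))%:~R else 1) => h.
  rewrite (bigD1 None) //= (reindex_omap Some id) /=; last by case.
  under eq_bigl => j do rewrite eqxx.
  rewrite E ffunE /= ffunE mul1r.
  under [in RHS]eq_bigr => j _ do rewrite ffunE -intrM.
  rewrite -rmorph_sum /= -intrD /fl; congr (_ %:~R).
  rewrite -[X in _ + X](@intrKfloor R) -floorDrz ?intr_int //.
  congr Num.floor; rewrite rmorph_sum -big_split /=; apply: eq_bigr => j _.
  by rewrite intrM /c' -mulrDl subrK.
Qed.

Lemma expandable_horner {R : realType} {X : Type} (N : X -> nat -> R)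
    (p : {poly R}) : expandable N -> expandable (fun x h => p.[N x h]).
Proof.
move=> eN; elim/poly_ind: p => [|p c IH].
  by apply: expandable_ext (expandable_cst (fun _ => 0)) => x h; rewrite horner0.
apply: expandable_ext
  (expandable_add (expandable_mul IH eN) (expandable_cst (fun _ => c))) => x h.
by rewrite hornerMXaddC.
Qed.

Lemma expandable_gp {R : realType} {X : Type} (N : X -> nat -> R)
    (g : R -> R) : gp g -> expandable N -> expandable (fun x h => g (N x h)).
Proof.
move=> gpg eN; elim: gpg => [p|f f' _ ef _ ef'|f f' _ ef _ ef'|f _ ef].
- exact: expandable_horner.
- exact: expandable_add.
- exact: expandable_mul.
- exact: expandable_fl.
Qed.

Lemma expandable_poly {R : realType} (m : nat) :
  expandable (fun (P : {P : {poly R} | (size P <= m)%N}) h => (sval P).[h%:R]).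
Proof.
apply: (@expandable_linear _ _ _ m m (fun (P : {P : {poly R} | (size P <= m)%N}) (i : 'I_m) => (sval P)`_i)
  (fun (i : 'I_m) (h : nat) => (h%:Z) ^+ i)).
  move=> i h; rewrite abszX absz_nat; apply: leq_trans (_ : h.+2 ^ i <= _)%N.
    by apply: leq_expn2r; rewrite ltnW.
  by rewrite leq_pexp2l // ltnW.
move=> [P sP] h /=; rewrite (horner_coef_wide _ sP).
by apply: eq_bigr => i _; rewrite rmorphXn.
Qed.

Lemma gp_cst {R : realType} (c : R) : gp (fun _ => c).
Proof.
have := gp_poly (c%:P); congr gp.
by apply/funext => x; rewrite hornerC.
Qed.

Lemma seq_nat_bound {T : eqType} (s : seq T) (f : T -> nat) :
  exists K, forall x, x \in s -> (f x <= K)%N.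
Proof.
elim: s => [|y s [K IH]]; first by exists 0.
exists (f y + K)%N => x; rewrite inE => /orP[/eqP ->|/IH fx].
  exact: leq_addr.
exact: leq_trans fx (leq_addl _ _).
Qed.

(** [K] exceeds every 1/|v - w|, so distinct values become more than 1 apart; pairs with v = w are
    harmless since the inverse of 0 is 0. *)
Lemma floor_mul_separates {R : realType} (s : seq R) : exists K : nat,
  forall v w, v \in s -> w \in s ->
    Num.floor (K%:R * v) = Num.floor (K%:R * w) -> v = w.
Proof.
have [K KP] := seq_nat_bound (allpairs pair s s)
  (fun z => (Num.truncn `|z.1 - z.2|^-1).+1).
exists K => v w vs ws vw; apply/eqP; rewrite -subr_eq0 -normr_eq0.
apply/negP => /negP d0; have {}d0 : 0 < `|v - w| by rewrite lt_def d0 normr_ge0.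
have Kd : 1 < K%:R * `|v - w|.
  rewrite -ltr_pdivrMr // mul1r.
  have : (v, w) \in allpairs pair s s by apply/allpairsP; exists (v, w).
  move=> /KP /= KP'; apply: (@lt_le_trans _ _ (Num.truncn `|v - w|^-1).+1%:R).
    exact: truncnS_gt.
  by rewrite ler_nat.
have {d0} : `|K%:R * v - K%:R * w| < 1.
  have := floor_le (K%:R * v); have := floorD1_gt (K%:R * v).
  have := floor_le (K%:R * w); have := floorD1_gt (K%:R * w).
  by rewrite vw !intrD ltr_norml; lra.
by rewrite -mulrBr normrM normr_nat ltNge ltW.
Qed.

(** Scaling, taking floors and shifting preserve generalised polynomials; they replace the finitely
    many real values of [g] by integers in [0, M), which allows arithmetic modulo [M]. *)
Lemma bracket_word_code {R : realType} {Sigma : finType} (a : int -> Sigma) :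
  bracket_word (R := R) a ->
  exists (g : R -> R) (M : nat) (dec : int -> Sigma), gp g /\
    forall n : int, exists k : int,
      [/\ 0 <= k < M%:Z, g n%:~R = k%:~R & a n = dec k].
Proof.
move=> [g [gpg [fing [pi api]]]].
have /finite_seqP[s sE] := fing.
have gs (n : int) : g n%:~R \in s.
  have : range (fun n : int => g n%:~R) (g n%:~R) by exists n.
  by rewrite sE.
have [K Kinj] := floor_mul_separates s.
have [M0 M0P] := seq_nat_bound s (fun v => absz (Num.floor (K%:R * v))).
exists (fun x => fl (K%:R * g x) + M0%:R), (M0.*2.+1).
pose code (v : R) : int := Num.floor (K%:R * v) + M0%:Z.
(* Integers that code no value of [g] get the letter [a 0] by default. *)
pose dec k := if pselect (exists v, v \in s /\ code v = k) is left P
  then pi (projT1 (cid P)) else a 0.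
exists dec; split.
  apply: gp_add (gp_cst _); apply: gp_floor; apply: gp_mul gpg.
  exact: gp_cst.
move=> n; exists (code (g n%:~R)); split.
- have := M0P _ (gs n); rewrite /code; lia.
- by rewrite /code intrD.
- rewrite api /dec; case: pselect => [P|nP].
    case: (cid P) => v [vs /= /addIr vE]; congr pi.
    by apply: Kinj => //; rewrite vE.
  by case: nP; exists (g n%:~R).
Qed.

(** The coded value is an integer sum of c_j u_j in [0, M). Bringing each [c j] into [0, M) by a
    multiple of [M] changes the sum by a multiple of [M], so reduction modulo [M] recovers the
    value, and [covered_floor_sum] counts the reduced sums. *)
Lemma covered_poly_words {R : realType} {Sigma : finType} (a : int -> Sigma)
    (m : nat) : bracket_word (R := R) a ->
  exists K, forall H, covered (H.+2 ^ K) (fun w : {ffun 'I_H -> Sigma} =>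
    exists2 P : {poly R}, (size P <= m)%N &
      forall h, w h = a (Num.floor P.[h%:R])).
Proof.
move=> /bracket_word_code[g [M [dec [gpg gP]]]].
have := expandable_gp _ g gpg (expandable_fl (@expandable_poly R m)).
move=> [J [K [A [cA bA eA]]]].
pose Q H (u : {ffun J * 'I_H -> int}) (v : {ffun 'I_H -> int}) :=
  exists2 c : J -> R, forall j, 0 <= c j <= M%:R &
    forall h, v h = Num.floor (\sum_j c j * (u (j, h))%:~R).
pose L := ((#|J| * M).*2.+2 + K + 1)%N.
exists (K + L * #|J|)%N => H.
have cQ u : A H u -> covered (H.+2 ^ (L * #|J|)) (Q H u).
  move=> Au; have := @covered_floor_sum R J H _ M u (bA H u Au).
  move=> /covered_weaken; apply => //.
  rewrite expnM leq_expn2r // mulnA /L.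
  rewrite !expnD expn1.
  have P1 : (0 < H.+2 ^ K)%N by rewrite expn_gt0.
  have P2 := leq_pow_self H ((#|J| * M).*2.+2).
  apply: (@leq_trans ((#|J| * M).*2.+2 * H.+2 ^ K * H.+2));
    last by rewrite !leq_mul.
  move: (H.+2 ^ K)%N (#|J| * M)%N P1 => b j P1.
  have -> : ((H * (j * b).*2.+1).+1 = j.*2 * b * H + H + 1)%N by lia.
  have -> : (j.*2.+2 * b * H.+2 = j.*2 * b * H + 2 * (b * H) +
    (j.*2 * b + b * 2).*2)%N by lia.
  have : (H <= b * H)%N by rewrite leq_pmull.
  by lia.
rewrite expnD.
apply: (covered_image (fun v : {ffun 'I_H -> int} =>
  [ffun h => dec (v h %% M)%Z]) _ (covered_dep _ (cA H) cQ)).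
move=> w [P sP wE]; have [u Au [c cE]] := eA H (exist _ P sP).
pose z j := Num.floor (c j / M%:R).
pose c' j := c j - M%:R * (z j)%:~R.
exists [ffun h => Num.floor (\sum_j c' j * (u (j, h))%:~R)].
  exists u; split => //; exists c' => [j|h]; last by rewrite ffunE.
  have [k [/andP[k0 kM] _ _]] := gP 0.
  have M0 : 0 < M%:R :> R by rewrite ltr0n; lia.
  have := floor_itv (c j / M%:R); rewrite -/(z j) intrD.
  rewrite ler_pdivlMr // ltr_pdivrMr // /c' => /andP[h1 h2].
  by apply/andP; split; lra.
apply/ffunP => h; rewrite !ffunE wE.
have [k [k0M gk ->]] := gP (Num.floor P.[h%:R]).
congr dec; have := cE h; rewrite /= /fl gk => kE.
have -> : \sum_j c' j * (u (j, h))%:~R =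
    (k - M%:Z * \sum_j z j * u (j, h))%:~R :> R.
  rewrite intrD intrN intrM kE.
  rewrite rmorph_sum mulr_sumr /= -sumrB; apply: eq_bigr => j _.
  by rewrite intrM /c' /z pmulrn; ring.
rewrite intrKfloor -mulrN addrC [M%:Z * _]mulrC modzMDl modz_small //.
Qed.

(** * Hardy field functions *)

Lemma near_pinfty_ex {R : realType} (P : R -> Prop) :
  (\forall x \near +oo, P x) -> exists T, forall t, T <= t -> P t.
Proof.
move=> [M [_ MP]]; exists (M + 1) => t Mt; apply: MP.
by apply: lt_le_trans Mt; rewrite ltrDl.
Qed.

Lemma normr_between {R : realType} (a b x : R) :
  a <= x -> x <= b -> `|x| <= Num.max `|a| `|b|.
Proof.
move=> ax xb; rewrite le_max; case: (lerP 0 x) => x0; apply/orP.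
  by right; rewrite ger0_norm // (le_trans xb) ?ler_norm.
left; rewrite ltr0_norm // -normrN.
by apply: le_trans (ler_norm _); rewrite lerN2.
Qed.

Definition derive_from {R : realType} (T : R) (f g : R -> R) : Prop :=
  forall t : R, T <= t -> is_derive t (1 : R) f (g t).

Lemma derive_from_continuous {R : realType} (T a b : R) (f g : R -> R) :
  derive_from T f g -> T <= a -> {within `[a, b], continuous f}%classic.
Proof.
move=> fg Ta; apply: continuous_in_subspaceT => x.
rewrite inE /= in_itv /= => /andP[ax _].
apply/differentiable_continuous/derivable1_diffP.
by have [] := fg x (le_trans Ta ax).
Qed.

Lemma derive_from_MVT {R : realType} (T a b : R) (f g : R -> R) :
  derive_from T f g -> T <= a -> a < b ->
  exists2 c, a < c < b & f b - f a = g c * (b - a).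
Proof.
move=> fg Ta ab; have [||c] := @MVT R f g a b ab.
- move=> x; rewrite in_itv /= => /andP[ax _]; apply: fg.
  exact: le_trans Ta (ltW ax).
- exact: derive_from_continuous fg Ta.
- by rewrite in_itv /= => cab E; exists c.
Qed.

Lemma hardy_derive {R : realType} (HF : set (R -> R)) (f : R -> R) :
  hardy_field HF -> HF f -> exists2 g, HF g & exists T, derive_from T f g.
Proof.
move=> [_ [_ _ _ Hd]] /Hd[g [Hg /near_pinfty_ex[T TP]]].
by exists g => //; exists T.
Qed.

(** A nonzero germ has an inverse in the field, so [f] eventually has no zeros; being eventually
    differentiable, it is continuous there, and the intermediate value theorem applies. *)
Lemma hardy_sign {R : realType} (HF : set (R -> R)) (f : R -> R) :
  hardy_field HF -> HF f -> exists b T, forall t, T <= t -> (0 <= f t) = b.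
Proof.
move=> hHF Hf; have [_ [_ _ Hi _]] := hHF.
have [|/(Hi f Hf)[k [_ /near_pinfty_ex[T1 fk]]]] := pselect (ev_eq f (fun _ => 0)).
  move=> /near_pinfty_ex[T f0]; exists true, T => t Tt.
  by rewrite f0 // lexx.
have [g _ [T2 fg]] := hardy_derive HF f hHF Hf.
pose T := Num.max T1 T2.
have fn0 t : T <= t -> f t != 0.
  rewrite ge_max => /andP[/fk fk1 _]; apply/eqP => f0; move: fk1.
  by rewrite f0 mul0r => /eqP; rewrite eq_sym oner_eq0.
exists (0 <= f T), T => t Tt; apply/idP/idP => f0.
all: apply/negPn/negP; rewrite -ltNge => fneg.
all: have T2T : T2 <= T by rewrite le_max lexx orbT.
all: have [|c] := @IVT R f T t 0 Tt (derive_from_continuous T2 T t f g fg T2T).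
all: try by rewrite in_itv /= => /andP[/fn0/eqP].
all: rewrite ge_min le_max ?f0 ?(ltW fneg) ?orbT //.
Qed.

Lemma hardy_monotone {R : realType} (HF : set (R -> R)) (f : R -> R) :
  hardy_field HF -> HF f -> exists b T, forall x y, T <= x -> x <= y ->
    if b then f x <= f y else f y <= f x.
Proof.
move=> hHF Hf; have [g Hg [T1 fg]] := hardy_derive HF f hHF Hf.
have [b [T2 gb]] := hardy_sign HF g hHF Hg.
exists b, (Num.max T1 T2) => x y; rewrite ge_max => /andP[T1x T2x].
rewrite le_eqVlt => /orP[/eqP ->|xy]; first by case: b {gb}.
have [c /andP[xc _] fE] := derive_from_MVT T1 x y f g fg T1x xy.
have := gb c (le_trans T2x (ltW xc)); case: b {gb} => gc.
  by rewrite -subr_ge0 fE mulr_ge0 // subr_ge0 ltW.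
by rewrite -subr_le0 fE mulr_le0_ge0 ?subr_ge0 ?ltW // ltNge gc.
Qed.

(* By monotonicity g t lies between the difference quotients of f over
   [t / 2, t] and [t, 2 t]. *)
Lemma derive_growth {R : realType} (T C : R) (j k : nat) (f g : R -> R)
    (b : bool) : derive_from T f g ->
  (forall x y, T <= x -> x <= y -> if b then g x <= g y else g y <= g x) ->
  (forall t, T <= t -> `|f t| * t ^+ j <= C * t ^+ k) ->
  exists T' C', forall t, T' <= t -> `|g t| * t ^+ j.+1 <= C' * t ^+ k.
Proof.
move=> fg gmono fC.
(* For s in [t/2, 2t], replacing s by 2t costs 2^k and replacing t by 2s costs 2^j. *)
pose C1 := `|C| * 2 ^+ (k + j).
(* Beyond this point t/2 exceeds both T and 0; the factor 4 comes from two values of [f] and an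
   interval of length at least t/2. *)
exists (2 * (`|T| + 1)), (4 * C1) => t Tt.
have T0 := normr_ge0 T; have TT := ler_norm T.
have t0 : 0 < t by lra.
have fbound s : t / 2 <= s -> s <= 2 * t -> `|f s| * t ^+ j <= C1 * t ^+ k.
  move=> s1 s2; have Ts : T <= s by lra.
  have s0 : 0 <= s by lra.
  apply: (@le_trans _ _ (`|f s| * (2 * s) ^+ j)).
    by rewrite ler_wpM2l // lerXn2r ?nnegrE //; lra.
  rewrite exprMn mulrCA; apply: (@le_trans _ _ (2 ^+ j * (C * s ^+ k))).
    by rewrite ler_wpM2l ?exprn_ge0 ?fC.
  apply: (@le_trans _ _ (2 ^+ j * (`|C| * (2 * t) ^+ k))).
    rewrite ler_wpM2l ?exprn_ge0 //.
    apply: (@le_trans _ _ (`|C| * s ^+ k)).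
      by rewrite ler_wpM2r ?ler_norm ?exprn_ge0.
    by rewrite ler_wpM2l // lerXn2r ?nnegrE //; lra.
  rewrite exprMn /C1 exprD.
  by rewrite [leLHS](_ : _ = `|C| * (2 ^+ k * 2 ^+ j) * t ^+ k); last ring.
have gbound x y : T <= x -> t / 2 <= x -> x < y -> y <= 2 * t -> t / 2 <= y - x ->
    exists2 c, x < c < y & `|g c| * t ^+ j.+1 <= 4 * C1 * t ^+ k.
  move=> Tx tx xy yt d; have [c xcy E] := derive_from_MVT T x y f g fg Tx xy.
  exists c => //.
  have fx := fbound x tx (ltW (lt_le_trans xy yt)).
  have fy := fbound y (le_trans tx (ltW xy)) yt.
  have tj : 0 <= t ^+ j by rewrite exprn_ge0 // ltW.
  have : `|g c| * (y - x) <= `|f y| + `|f x|.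
    have yx0 : 0 <= y - x by lra.
    rewrite -{1}(ger0_norm yx0) -normrM -E; exact: ler_normB.
  move=> /(ler_wpM2r tj); rewrite mulrDl => h1.
  have : `|g c| * (t / 2) * t ^+ j <= `|g c| * (y - x) * t ^+ j.
    by rewrite ler_wpM2r // ler_wpM2l.
  rewrite exprS; lra.
have tj1 : 0 <= t ^+ j.+1 by rewrite exprn_ge0 // ltW.
have [|||||c1 /andP[c1x c1y] E1] := gbound (t / 2) t; try lra.
have [|||||c2 /andP[c2x c2y] E2] := gbound t (2 * t); try lra.
have : `|g t| <= Num.max `|g c1| `|g c2|.
  have Tc1 : T <= c1 by lra.
  have := gmono t c2; have := gmono c1 t Tc1 (ltW c1y); case: b {gmono} => h1 h2.
    by apply: normr_between h1 (h2 _ _); lra.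
  by rewrite maxC; apply: normr_between (h2 _ _) h1; lra.
rewrite le_max => /orP[] h; [apply: le_trans E1|apply: le_trans E2];
  by rewrite ler_wpM2r.
Qed.

Definition diff {R : realType} (g : R -> R) : R -> R :=
  fun t => g (t + 1) - g t.

Lemma derive_from_diff {R : realType} (T : R) (f g : R -> R) :
  derive_from T f g -> derive_from T (diff f) (diff g).
Proof.
move=> fg t Tt; rewrite /diff.
have ft1 : is_derive t (1 : R) (fun t => f (t + 1)) (g (t + 1)).
  have d1 : is_derive t (1 : R) (fun t => t + 1) 1.
    rewrite -[X in is_derive _ _ _ X](addr0 1).
    exact: (is_deriveD (is_derive_id t (1 : R)) (is_derive_cst (1 : R) t 1)).
  have Tt1 : T <= t + 1 by lra.
  have dft1 := fg _ Tt1.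
  by have := @is_derive1_comp _ f (fun t => t + 1) t (g (t + 1)) 1 dft1 d1;
    rewrite mulr1.
have ft := fg _ Tt.
exact: is_deriveB.
Qed.

(** By [m] uses of the mean value theorem, the difference of order [m] at t is a value of the
    derivative of order [m] at or after t; [P] carries over what holds there. *)
Lemma diff_derive_value {R : realType} (m : nat) (F : nat -> R -> R) (T : R)
    (P : R -> Prop) :
  (forall i, (i < m)%N -> derive_from T (F i) (F i.+1)) ->
  (forall t, T <= t -> P (F m t)) -> forall t, T <= t -> P (iter m diff (F 0) t).
Proof.
elim: m F => [|m IH] F dF PF t Tt; first exact: PF.
have dm : derive_from T (iter m diff (F 0)) (iter m diff (F 1)).
  have := dF 0 isT; elim: (m) => //= k; move=> /[apply].
  exact: derive_from_diff.
have [|c /andP[tc _] E] := derive_from_MVT T t (t + 1) _ _ dm Tt; first lra.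
rewrite iterS {1}/diff E -addrA addrC subrK mulr1.
apply: (IH (fun i => F i.+1)) => [i im||]; [exact: dF|exact: PF|lra].
Qed.

(** Representatives of the successive derivatives are chosen one after another, each valid on its
    own half-line; [T] serves finitely many of them. *)
Lemma hardy_derivatives {R : realType} (HF : set (R -> R)) (f : R -> R) :
  hardy_field HF -> HF f -> exists F : nat -> R -> R,
    [/\ F 0 = f, forall i, HF (F i)
      & forall m, exists T, forall i, (i < m)%N -> derive_from T (F i) (F i.+1)].
Proof.
move=> hHF Hf.
have dP (g : {g | HF g}) : {g' : {g | HF g} | exists T, derive_from T (sval g) (sval g')}.
  apply: cid; case: g => g Hg /=; have [g' Hg' dg] := hardy_derive HF g hHF Hg.
  by exists (exist _ g' Hg').
pose G i := iter i (fun g => sval (dP g)) (exist _ f Hf).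
exists (fun i => sval (G i)); split=> // [i|]; first exact: (svalP (G i)).
elim=> [|m [T TP]]; first by exists 0.
have [T' T'P] := svalP (dP (G m)).
exists (Num.max T T') => i; rewrite ltnS leq_eqVlt => /orP[/eqP ->|im] t.
  by rewrite ge_max => /andP[_]; apply: T'P.
by rewrite ge_max => /andP[+ _]; apply: TP.
Qed.

Lemma poly_growth_bound {R : realType} (f : R -> R) : poly_growth f ->
  exists (k : nat) (T : R), forall t, T <= t -> `|f t| <= t ^+ k.
Proof.
move=> [k /cvgrPdist_lt /(_ 1 ltr01) /near_pinfty_ex[T TP]].
exists k, (Num.max T 1) => t; rewrite ge_max => /andP[/TP].
rewrite sub0r normrN normrM normfV => h t1.
have tk : 0 < t ^+ k by rewrite exprn_gt0 // (lt_le_trans ltr01).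
by move: h; rewrite (ger0_norm (ltW tk)) ltr_pdivrMr // mul1r => /ltW.
Qed.

(** With [f] of order O(t^k), the derivative of order k + 1 is O(1/t) and eventually of constant
    sign, and both properties pass to the difference of order m = k + 1. *)
Lemma hardy_differences {R : realType} (f : R -> R) :
  hardy_function f -> poly_growth f ->
  exists (m : nat) (b : bool) (C n0 : nat), (0 < m)%N /\
    forall n : nat, (n0 < n)%N ->
    forall k : nat, (n <= k)%N -> (0 <= iter m diff f k%:R) = b /\
      `|iter m diff f k%:R| <= C%:R / n%:R.
Proof.
move=> [HF [hHF Hf]] /poly_growth_bound[k [T0 fk]].
have [F [F0 HFF dF]] := hardy_derivatives HF f hHF Hf.
(* [F j] is O(t^(k-j)), stated without negative exponents. *)
have growth j : exists T C, forall t, T <= t -> `|F j t| * t ^+ j <= C * t ^+ k.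
  elim: j => [|j [T1 [C FC]]].
    by exists T0, 1 => t /fk; rewrite F0 mulr1 mul1r.
  have [T2 dFj] := dF j.+1.
  have [b [T3 mono]] := hardy_monotone HF (F j.+1) hHF (HFF _).
  pose T := Num.max T1 (Num.max T2 T3).
  have TP t : T <= t -> [/\ T1 <= t, T2 <= t & T3 <= t].
    by rewrite !ge_max => /and3P[].
  apply: (derive_growth T C j k (F j) (F j.+1) b).
  - by move=> t /TP[_ ? _]; apply: dFj.
  - by move=> x y /TP[_ _ ?]; apply: mono.
  - by move=> t /TP[? _ _]; apply: FC.
have [T1 [C FC]] := growth k.+1.
have [T2 dFk] := dF k.+1.
have [b [T3 sgnF]] := hardy_sign HF (F k.+1) hHF (HFF _).
exists k.+1, b, (Num.truncn `|C|).+1.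
exists (Num.truncn (`|T1| + `|T2| + `|T3|)).+1; split=> // n n0 i ni.
have : `|T1| + `|T2| + `|T3| < n%:R.
  by apply: lt_le_trans (truncnS_gt _) _; rewrite ler_nat ltnW.
move=> nT; rewrite -F0.
have := normr_ge0 T1; have := normr_ge0 T2; have := normr_ge0 T3.
have := ler_norm T1; have := ler_norm T2; have := ler_norm T3 => ? ? ? ? ? ?.
apply: (diff_derive_value k.+1 F n%:R
  (fun y => (0 <= y) = b /\ `|y| <= _)); last by rewrite ler_nat.
  by move=> j jk t nt; apply: dFk => //; lra.
move=> t nt; split; first by apply: sgnF; lra.
have npos : 0 < n%:R :> R by lra.
have t0 : 0 < t by lra.
have tk : 0 < t ^+ k by rewrite exprn_gt0.
have {}FC : `|F k.+1 t| * t <= C.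
  by rewrite -(ler_pM2r tk) -mulrA -exprS FC //; lra.
rewrite ler_pdivlMr //.
apply: (@le_trans _ _ (`|F k.+1 t| * t)); first by rewrite ler_wpM2l.
apply: (le_trans FC); apply: (le_trans (ler_norm _)); exact/ltW/truncnS_gt.
Qed.

(** * Finite differences and sign changes *)

Definition sdiff {R : realType} (s : nat -> R) : nat -> R :=
  fun h => s h.+1 - s h.

Lemma iter_sdiff {R : realType} (m : nat) (g : R -> R) (N h : nat) :
  iter m sdiff (fun h => g (N + h)%:R) h = iter m diff g (N + h)%:R.
Proof.
elim: m h => //= m IH h; rewrite /sdiff /diff !IH.
by rewrite addnS -addn1 natrD.
Qed.

Lemma iter_sdiffB {R : realType} (m : nat) (s t : nat -> R) (h : nat) :
  iter m sdiff (fun h => s h - t h) h = iter m sdiff s h - iter m sdiff t h.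
Proof. by elim: m h => //= m IH h; rewrite /sdiff !IH; ring. Qed.

Lemma iter_sdiff_horner {R : realType} (m : nat) (p : {poly R}) (h : nat) :
  (size p <= m)%N -> iter m sdiff (fun h => p.[h%:R]) h = 0.
Proof.
move=> sp; rewrite (iter_sdiff m (horner p) 0) add0n.
apply: (@diff_derive_value R m (fun i => horner p^`(i)) 0 (fun y => y = 0)) => //.
  by move=> i _ t _; rewrite derivnS; apply: is_derive_poly.
by move=> t _; rewrite derivn_poly0 // horner0.
Qed.

(** The Newton interpolation error vanishes at 0 and, by Pascal's rule, its difference is the error
    of lower order for [sdiff s]; summing at most [H] steps costs a factor [H]. *)
Lemma newton_error {R : realType} (m H : nat) (s : nat -> R) (eta : R) :
  (forall j, (j < H)%N -> `|iter m sdiff s j| <= eta) ->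
  forall h, (h < H)%N ->
  `|s h - \sum_(i < m) iter i sdiff s 0 * 'C(h, i)%:R| <= H%:R ^+ m * eta.
Proof.
elim: m s => [|m IH] s sP h hH; first by rewrite big_ord0 subr0 mul1r; apply: sP.
pose D h := s h - \sum_(i < m.+1) iter i sdiff s 0 * 'C(h, i)%:R.
have DS j : D j.+1 - D j =
    sdiff s j - \sum_(i < m) iter i sdiff (sdiff s) 0 * 'C(j, i)%:R.
  rewrite /D !big_ord_recl !bin0 /=.
  under [X in _ - (_ + X) - _]eq_bigr => i _ do
    rewrite /bump /= add1n binS natrD mulrDr -iterS iterSr.
  under [X in _ - (_ - (_ + X))]eq_bigr => i _ do
    rewrite /bump /= add1n -iterS iterSr.
  by rewrite big_split /= /sdiff; ring.
have Dle j : (j < H)%N -> `|D j| <= j%:R * (H%:R ^+ m * eta).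
  elim: j => [|j IHj] jH.
    rewrite mul0r /D big_ord_recl big1 => [|i _]; last by rewrite bin0n mulr0.
    by rewrite bin0 mulr1 addr0 subrr normr0.
  rewrite -natr1 mulrDl mul1r -[D _](subrK (D j)) addrC.
  apply: (le_trans (ler_normD _ _)); apply: lerD; first exact: IHj (ltnW jH).
  rewrite DS; apply: IH => [i iH|]; last exact: ltnW.
  by rewrite -iterSr; apply: sP.
apply: (le_trans (Dle h hH)); rewrite exprS -mulrA ler_wpM2r ?ler_nat 1?ltnW //.
rewrite mulr_ge0 ?exprn_ge0 //.
exact: le_trans (sP h hH).
Qed.

(** The binomial coefficient X (X - 1) ... (X - i + 1) / i! as a polynomial. *)
Definition binp {R : realType} (i : nat) : {poly R} :=
  (i`!%:R)^-1 *: \prod_(j < i) ('X - (j%:R)%:P).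

Lemma horner_binp {R : realType} (i h : nat) :
  (binp i).[h%:R] = 'C(h, i)%:R :> R.
Proof.
have fi : i`!%:R != 0 :> R by rewrite pnatr_eq0 -lt0n fact_gt0.
rewrite hornerZ; apply: (mulfI fi); rewrite mulrA mulfV // mul1r -natrM.
rewrite mulnC bin_ffact horner_prod {fi}.
elim: i => [|i IH]; first by rewrite big_ord0.
rewrite big_ord_recr /= IH hornerXsubC ffactnSr natrM.
have [ih|hi] := leqP i h; first by rewrite natrB.
by rewrite ffact_small // !mul0r.
Qed.

Lemma size_binp {R : realType} (i : nat) : (size (@binp R i) <= i.+1)%N.
Proof.
apply: leq_trans (size_scale_leq _ _) _.
by rewrite size_prod_XsubC /index_enum -enumT size_enum_ord.
Qed.

Lemma newton_poly {R : realType} (m H : nat) (s : nat -> R) (eta : R) :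
  (forall j, (j < H)%N -> `|iter m sdiff s j| <= eta) ->
  exists2 P : {poly R}, (size P <= m)%N & forall h, (h < H)%N ->
    `|s h - P.[h%:R]| <= H%:R ^+ m * eta.
Proof.
move=> sP; exists (\sum_(i < m) (iter i sdiff s 0) *: binp i).
  apply: (leq_trans (size_sum _ _ _)); apply/bigmax_leqP => i _.
  exact: leq_trans (size_scale_leq _ _) (leq_trans (size_binp i) (ltn_ord i)).
move=> h /(newton_error _ _ _ _ sP); rewrite horner_sum.
by under eq_bigr => i _ do rewrite -horner_binp -hornerZ.
Qed.

Definition changes (T : nat -> bool) (n : nat) : nat :=
  \sum_(i < n) (T i != T i.+1).

Lemma changesS (T : nat -> bool) (n : nat) :
  changes T n.+1 = (changes T n + (T n != T n.+1))%N.
Proof. exact: big_ord_recr. Qed.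

Lemma changes_eq0 (T : nat -> bool) (n : nat) : changes T n = 0%N ->
  forall h, (h <= n)%N -> T h = T 0%N.
Proof.
elim: n => [|n IH]; first by move=> _ h; rewrite leqn0 => /eqP ->.
rewrite changesS => /eqP; rewrite addn_eq0 eqb0 negbK.
move=> /andP[/eqP/IH{}IH /eqP TS] h; rewrite leq_eqVlt => /orP[/eqP ->|/IH//].
by rewrite -TS IH.
Qed.

(** Each change has a true end, and each true value is an end of at most two changes; since [T n] is
    false, only values before [n] occur. *)
Lemma changes_leq_count (T : nat -> bool) (n : nat) : T n = false ->
  (changes T n <= (\sum_(i < n) T i).*2)%N.
Proof.
move=> Tn; have : (\sum_(i < n.+1) T i = \sum_(i < n) T i)%N.
  by rewrite big_ord_recr /= Tn addn0.
rewrite big_ord_recl /= => SE; rewrite -addnn -[X in (_ <= _ + X)%N]SE addnCA.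
apply: (@leq_trans (\sum_(i < n) (T i + T i.+1))); last by rewrite big_split leq_addl.
by apply: leq_sum => i _; case: (T i); case: (T _).
Qed.

(** A discrete Rolle theorem: when [s] changes sign, [sdiff s] has the new sign of [s], so
    consecutive changes of [s] force a change of [sdiff s] between them. *)
Lemma changes_sdiff {R : realType} (s : nat -> R) (n : nat) :
  (changes (fun h => (0 <= s h)%R) n <= (changes (fun h => (0 <= sdiff s h)%R) n).+1)%N.
Proof.
have turn h : (0 <= s h) != (0 <= s h.+1) -> (0 <= sdiff s h) = (0 <= s h.+1).
  rewrite /sdiff; case: (lerP 0 (s h)); case: (lerP 0 (s h.+1)) => //= h1 h2 _.
    by apply/negbTE; rewrite -ltNge; lra.
  by apply/idP; lra.
(* The induction uses a sharper form: the additional 1 is counted only if [sdiff s k] and [s k.+1]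
   have the same sign. *)
suff sharp k : (changes (fun h => (0 <= s h)%R) k.+1 <=
    changes (fun h => (0 <= sdiff s h)%R) k + ((0 <= sdiff s k) == (0 <= s k.+1))%R)%N.
  case: n => [|n]; first by rewrite /changes !big_ord0.
  apply: leq_trans (sharp n) _; rewrite [in leqRHS]/changes big_ord_recr /=.
  by rewrite -addnS leq_add2l (leq_trans (leq_b1 _)).
elim: k => [|k IH].
  rewrite /changes big_ord_recr !big_ord0 /= !add0n.
  by case: eqP => // /eqP /turn ->; rewrite eqxx.
rewrite changesS [in leqRHS]changesS; move: (turn k.+1) IH.
move: (changes _ k.+1) (changes _ k) => c d.
case: (0 <= s k.+1) (0 <= s k.+2) (0 <= sdiff s k) (0 <= sdiff s k.+1).
all: by case; case; case=> //= t; try (by have := t isT); lia.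
Qed.

Lemma changes_iter_sdiff {R : realType} (m : nat) (s : nat -> R) (n : nat) :
  (changes (fun h => (0 <= s h)%R) n <=
   changes (fun h => (0 <= iter m sdiff s h)%R) n + m)%N.
Proof.
elim: m s => [|m IH] s; first by rewrite addn0.
apply: leq_trans (changes_sdiff _ _) _; rewrite addnS ltnS.
by under [in leqRHS]eq_fun => h do rewrite iterSr; apply: IH.
Qed.

(** Flipping all values after one change removes that change and keeps the others, so each further
    change multiplies the count by the number of positions. *)
Lemma covered_changes (H K : nat) :
  covered (H.+2 ^ K.+1) (fun T : {ffun 'I_H -> bool} =>
    exists2 T' : nat -> bool, (changes T' H <= K)%N & forall h, T h = T' h).
Proof.
elim: K => [|K IH].
  rewrite expn1; set A := (A in covered _ A).
  have cb := covered_finType bool (fun=> True).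
  have /covered_weaken : covered #|{: bool}| A.
    apply: (covered_image (fun b => [ffun _ => b]) _ cb) => T [T' + TT'].
    rewrite leqn0 => /eqP/changes_eq0 T'0; exists (T' 0%N) => //.
    by apply/ffunP => h; rewrite ffunE TT' T'0 // ltnW.
  by apply; rewrite ?card_bool.
have cI := covered_finType 'I_H.+1 (fun=> True).
set A := (A in covered _ A).
suff /covered_weaken : covered (H.+2 ^ K.+1 * #|'I_H.+1|)%N A.
  by apply=> //; rewrite [leqRHS]expnSr card_ord leq_mul.
apply: (covered_image (fun z : {ffun 'I_H -> bool} * 'I_H.+1 =>
  [ffun h : 'I_H => z.1 h (+) (z.2 < h)%N]) _ (covered_pair IH cI)).
move=> T [T' cT' TT'].
have [cT|cT] := leqP (changes T' H) K.
  (* The position [H] flips nothing on [0, H). *)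
  exists (T, ord_max); first by split=> //; exists T'.
  by apply/ffunP => h; rewrite ffunE /= ltnNge ltnW // addbF.
have [p pT] : exists p : 'I_H, T' p != T' p.+1.
  apply/existsP; apply: contraTT cT => /existsPn nT.
  rewrite /changes big1 // => i _; apply/eqP; rewrite eqb0; exact: nT.
pose T1 h := T' h (+) (p < h)%N.
exists ([ffun h : 'I_H => T1 h], widen_ord (leqnSn H) p); last first.
  by apply/ffunP => h; rewrite !ffunE /T1 TT' /= addbK.
split=> //; exists T1; last by move=> h; rewrite ffunE.
move: cT'; rewrite /changes (bigD1 p) //= pT add1n ltnS => cT'.
rewrite (bigD1 p) //= /T1 ltnn ltnSn addbF addbT.
rewrite (_ : T' p != ~~ T' p.+1 = false) ?add0n; last first.
  by move: pT; case: (T' p); case: (T' _).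
apply: leq_trans cT'; apply: leq_sum => i ip.
rewrite (_ : (p < i)%N = (p < i.+1)%N); first by case: (_ < _)%N; case: (T' i); case: (T' _).
by rewrite ltnS [in RHS]leq_eqVlt eq_sym (negbTE (_ : i != p :> nat)).
Qed.

(** * Floors of nearly polynomial sequences *)

Lemma floor_eq_int {R : realType} (x y : R) :
  (forall n : int, (n%:~R <= x) = (n%:~R <= y)) -> Num.floor x = Num.floor y.
Proof.
move=> xy; apply/eqP; rewrite eq_le !floor_ge_int -xy floor_le xy floor_le.
by [].
Qed.

(** Since [y] is a multiple of 1/q, integers other than [y] are more than [e] away from it; so only
    the sign of [rho] can matter, and it does when [y] is an integer. *)
Lemma floor_near_rational {R : realType} (y rho e : R) (q z : int) :
  q != 0 -> q%:~R * y = z%:~R -> `|rho| <= e -> `|q|%:~R * e < 1 ->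
  Num.floor (y + rho) = Num.floor (if 0 <= rho then y else y - e).
Proof.
move=> q0 qy rhoe qe.
have gap (n : int) : n%:~R != y -> e < `|n%:~R - y|.
  move=> ny; have qn : q * n - z != 0.
    apply: contraNneq ny => /eqP; rewrite subr_eq0 => /eqP qnz.
    by rewrite -(inj_eq (@mulfI _ q%:~R _)) ?intr_eq0 // qy -intrM qnz.
  have q1 : 0 < `|q|%:~R :> R by rewrite ltr0z normr_gt0.
  rewrite -(ltr_pM2l q1); apply: (lt_le_trans qe).
  rewrite intr_norm -normrM mulrBr qy -intrM -intrB -intr_norm ler1z.
  by rewrite -gtz0_ge1 normr_gt0.
move: rhoe; rewrite ler_norml => /andP[h1 h2].
apply: floor_eq_int => n.
have [->|/gap] := eqVneq (n%:~R) y.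
  by case: (lerP 0 rho) => r0; apply/idP/idP => h; lra.
case: (ger0P (n%:~R - y)) => d ne.
all: by case: (lerP 0 rho) => r0; apply/idP/idP => h; lra.
Qed.

(** [Q] is the Lagrange interpolation of the integers [n k] at the nodes [x k]. Its denominators are
    the products [W k] of node differences, and [q] is their product; as |W k| >= 1, each error
    [eps] grows at most by the numerator. *)
Lemma rational_interpolation {R : realType} (m H : nat) (P : {poly R})
    (x : nat -> nat) (n : nat -> int) (eps : R) :
  (size P <= m)%N -> {in gtn m &, injective x} ->
  (forall k, (k < m)%N -> (x k < H)%N) ->
  (forall k, (k < m)%N -> `|P.[(x k)%:R] - (n k)%:~R| <= eps) ->
  exists (Q : {poly R}) (q : int), [/\ (size Q <= m)%N, q != 0,
    (`|q| <= H.+2 ^ (m * m))%N,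
    forall h : nat, exists z : int, q%:~R * Q.[h%:R] = z%:~R &
    forall h : nat, (h < H)%N ->
      `|P.[h%:R] - Q.[h%:R]| <= m%:R * (eps * (H.+2 ^ m)%:R)].
Proof.
move=> sP xinj xH nP.
pose l (k : 'I_m) (h : nat) : int := \prod_(j < m | j != k) (h%:Z - (x j)%:Z).
pose L (k : 'I_m) : {poly R} := \prod_(j < m | j != k) ('X - ((x j)%:R)%:P).
have LE k h : (L k).[h%:R] = (l k h)%:~R.
  rewrite horner_prod rmorph_prod; apply: eq_bigr => j _.
  by rewrite hornerXsubC rmorphB.
have sL k : (size (L k) <= m)%N.
  rewrite /L -big_filter size_prod_XsubC size_filter -sum1_count sum1_card.
  by rewrite cardC1 card_ord; case: (m) k => [[]|].
pose W k := l k (x k).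
have W0 k : W k != 0.
  apply/prodf_neq0 => j jk; rewrite subr_eq0 eqz_nat.
  by apply: contra jk => /eqP/xinj kj; apply/eqP/val_inj/esym/kj; rewrite inE.
have W0R k : (W k)%:~R != 0 :> R by rewrite intr_eq0.
have lG k h : (h < H)%N -> (`|l k h| <= H.+2 ^ m)%N.
  move=> hH; rewrite /l (big_morph absz abszM (erefl _ : `|1%:Z|%N = 1%N)).
  apply: (@leq_trans (\prod_(j < m | j != k) H.+2)).
    apply: leq_prod => j _; have := xH j (ltn_ord j); lia.
  rewrite prod_nat_const leq_pexp2l //.
  by rewrite -[leqRHS]card_ord max_card.
have lx k j : j != k -> l k (x j) = 0.
  by move=> jk; rewrite /l (bigD1 j) //= subrr mul0r.
pose lin (c : 'I_m -> R) := \sum_k (c k / (W k)%:~R) *: L k.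
have linE c h : (lin c).[h%:R] = \sum_k c k * (l k h)%:~R / (W k)%:~R.
  rewrite horner_sum; apply: eq_bigr => k _; rewrite hornerZ LE.
  by rewrite mulrAC.
have slin c : (size (lin c) <= m)%N.
  apply: (leq_trans (size_sum _ _ _)); apply/bigmax_leqP => k _.
  exact: leq_trans (size_scale_leq _ _) (sL k).
(* [P] is its own Lagrange interpolation: the difference has size at most [m] and [m] roots. *)
have PE : P = lin (fun k => P.[(x k)%:R]).
  apply/eqP; rewrite -subr_eq0; apply/eqP.
  pose rs : seq R := [seq (x k)%:R | k <- iota 0 m].
  apply: (@roots_geq_poly_eq0 _ _ rs).
  - apply/allP => _ /mapP[k + ->]; rewrite mem_iota add0n => /= km.
    rewrite /root hornerD hornerN linE (bigD1 (Ordinal km)) //=.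
    rewrite big1 => [|j jk]; last first.
      rewrite eq_sym in jk.
      by have /= -> := lx j (Ordinal km) jk; rewrite mulr0 mul0r.
    by rewrite addr0 mulfK ?subrr // W0R.
  - rewrite map_inj_in_uniq ?iota_uniq // => i j.
    rewrite !mem_iota !add0n => /= im jm /eqP; rewrite eqr_nat => /eqP.
    exact: xinj.
  - rewrite size_map size_iota; apply: leq_trans (size_polyD _ _) _.
    by rewrite size_polyN geq_max sP slin.
exists (lin (fun k => (n k)%:~R)), (\prod_k W k); split => //.
- exact/prodf_neq0.
- rewrite (big_morph absz abszM (erefl _ : `|1%:Z|%N = 1%N)) expnM.
  apply: (@leq_trans (\prod_(k < m) H.+2 ^ m)).
    by apply: leq_prod => k _; apply/lG/xH.
  by rewrite prod_nat_const card_ord.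
- move=> h; exists (\sum_(k < m) n k * l k h * \prod_(j < m | j != k) W j).
  rewrite linE mulr_sumr rmorph_sum; apply: eq_bigr => k _.
  rewrite (bigD1 k) //= !intrM.
  by field; apply: W0R.
- move=> h hH; rewrite [in P.[_]]PE !linE -sumrB.
  apply: (le_trans (ler_norm_sum _ _ _)).
  apply: (@le_trans _ _ (\sum_(k < m) (eps * (H.+2 ^ m)%:R))).
    apply: ler_sum => k _; rewrite -!mulrBl -mulrA normrM ler_pM ?nP //.
    rewrite normrM normfV -[leRHS]mulr1 ler_pM ?invr_ge0 //.
      by rewrite -intr_norm -abszE ler_nat lG.
    rewrite invf_le1 ?normr_gt0 // -intr_norm ler1z -gtz0_ge1 normr_gt0.
    exact: W0.
  by rewrite sumr_const card_ord mulr_natl.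
Qed.

Lemma natr_lt1 {R : realType} (G B m : nat) (x eta : R) :
  (0 < G)%N -> (m <= B)%N -> 0 <= eta -> x <= (G ^ m)%:R * eta ->
  (G ^ B)%:R * eta < 1 -> x < 1.
Proof.
move=> G0 mB eta0 xe; apply: le_lt_trans; apply: (le_trans xe).
by rewrite ler_wpM2r // ler_nat leq_pexp2l.
Qed.

(* Let P approximate s within eps. If fewer than m of the P h are within eps of
   an integer, P + eps and P - eps do the job; otherwise P is close to a
   rational polynomial Q of small denominator, and the sign of s - Q decides
   between Q and Q - eps'. *)
Lemma floor_two_polys {R : realType} (m H : nat) (b : bool) (s : nat -> R)
    (eta : R) : 0 <= eta -> (0 < m)%N ->
  (forall j, (0 <= iter m sdiff s j) = b /\ `|iter m sdiff s j| <= eta) ->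
  (H.+2 ^ (m * m + 3 * m + 2))%:R * eta < 1 ->
  exists (P1 P2 : {poly R}) (T : nat -> bool),
    [/\ (size P1 <= m)%N, (size P2 <= m)%N, (changes T H <= m.*2)%N &
    forall h, (h < H)%N ->
      Num.floor (s h) = Num.floor (if T h then P1.[h%:R] else P2.[h%:R])].
Proof.
move=> eta0 m0 sP eta1.
have [P sizeP Perr] := @newton_poly R m H s eta (fun j _ => (sP j).2).
pose eps := (H.+2 ^ m)%:R * eta.
have eps0 : 0 <= eps by rewrite mulr_ge0.
have {}Perr h : (h < H)%N -> `|s h - P.[h%:R]| <= eps.
  move=> /Perr /le_trans; apply; rewrite ler_wpM2r // -natrX ler_nat.
  by apply: leq_expn2r; rewrite ltnW.
have size_cst (c : R) (Q : {poly R}) : (size Q <= m)%N -> (size (Q + c%:P)%R <= m)%N.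
  move=> sQ; apply: leq_trans (size_polyD _ _) _; rewrite geq_max sQ /=.
  exact: leq_trans (size_polyC_leq1 _) m0.
pose bad h := `[< exists n : int, `|P.[h%:R] - n%:~R| <= eps >].
pose S := [seq h <- iota 0 H | bad h].
have [Sm|mS] := ltnP (size S) m.
  (* Away from bad points the floors of [s], P + eps and P - eps agree, so [T] can be false there.
     The condition [h < H] makes [T H] false. *)
  pose T h := [&& (h < H)%N, bad h & Num.floor (s h) == Num.floor (P.[h%:R] + eps)].
  exists (P + eps%:P), (P + (- eps)%:P), T; split; rewrite ?size_cst //.
    apply: leq_trans (changes_leq_count _ _ _) _; first by rewrite /T ltnn.
    rewrite leq_double; apply: leq_trans (ltnW Sm).
    rewrite /S size_filter -sum1_count -[H in iota 0 H]subn0 big_mkord.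
    rewrite [leqRHS]big_mkcond /=; apply: leq_sum => i _.
    by rewrite /T; case: (bad i); rewrite ?andbF //; case: (_ && _).
  move=> h hH; rewrite !hornerD !hornerC /T hH /=.
  have := Perr h hH; rewrite ler_norml => /andP[e1 e2].
  have [hb|hb] := boolP (bad h); last first.
    apply: floor_eq_int => n; apply/idP/idP => hn; last by lra.
    rewrite leNgt; apply/negP => hn'; move/negP: hb; apply; apply/asboolP.
    by exists n; rewrite ler_norml; apply/andP; split; lra.
  (* As 2 eps < 1, the floors of P - eps and P + eps differ by at most 1, so [s] has the floor of
     one of them. *)
  case: eqP => [//|sn]; apply/eqP; rewrite eq_le.
  have eps1 : 2 * eps < 1.
    apply: (@natr_lt1 R H.+2 _ m.+1 _ eta) eta1 => //; first by lia.
    by rewrite expnS natrM -mulrA ler_wpM2r // ler_nat.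
  rewrite [X in _ && X]le_floor ?andbT; last by lra.
  have h1 : Num.floor (s h) < Num.floor (P.[h%:R] + eps).
    by rewrite lt_neqAle; apply/andP; split; [apply/eqP|apply: le_floor; lra].
  rewrite -ltzD1; apply: (lt_le_trans h1); rewrite -ltzD1 floor_lt_int.
  have := floorD1_gt (P.[h%:R] - eps); rewrite !intrD; lra.
pose x k := nth 0%N S k.
have Sx k : (k < m)%N -> x k \in S.
  by move=> km; apply: mem_nth; apply: leq_trans mS.
have xP k : (k < m)%N -> bad (x k) /\ (x k < H)%N.
  by move=> /Sx; rewrite mem_filter mem_iota => /andP[].
have xinj : {in gtn m &, injective x}.
  move=> i j; rewrite !inE => im jm /eqP.
  rewrite nth_uniq ?(leq_trans im) ?(leq_trans jm) //; first by move/eqP.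
  by rewrite filter_uniq // iota_uniq.
have nP k : exists n : int, (k < m)%N -> `|P.[(x k)%:R] - n%:~R| <= eps.
  have [km|km] := ltnP k m; last by exists 0.
  by have [/asboolP[n nP] _] := xP k km; exists n.
have [n {}nP] := choice nP.
have [Q [q [sQ q0 qG qQ PQ]]] := rational_interpolation m H P x n eps sizeP xinj
  (fun k km => (xP k km).2) nP.
pose e := eps + m%:R * (eps * (H.+2 ^ m)%:R).
(* With G = H.+2 and g = G^m: |q| <= G^(m m) and e = (g + m g^2) eta <= 2 g^3 eta <= G g^3 eta. *)
have qe : `|q|%:~R * e < 1.
  apply: (@natr_lt1 R H.+2 _ (m * m + (m.+1 + m + m)) _ eta) eta1 => //.
    by lia.
  rewrite -abszE -pmulrn expnD natrM -mulrA ler_pM ?ler_nat //.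
    by rewrite addr_ge0 // !mulr_ge0.
  rewrite /e /eps !expnD expnS !natrM.
  have G1 : 1 <= (H.+2 ^ m)%:R :> R by rewrite ler1n expn_gt0.
  have Gm : m%:R <= (H.+2 ^ m)%:R :> R by rewrite ler_nat leq_pow_self.
  have H2 : 2 <= H.+2%:R :> R by rewrite ler_nat.
  move: (H.+2 ^ m)%:R (m%:R) G1 Gm => g u G1 Gu.
  have g0 : 0 <= g by lra.
  have gg : g <= g * g by rewrite ler_peMl.
  have ggg : g * g <= g * g * g by rewrite ler_peMr ?mulr_ge0.
  have ugg : u * (g * g) <= g * (g * g) by rewrite ler_wpM2r ?mulr_ge0.
  have h1 := ler_wpM2r eta0 (le_trans gg ggg).
  have h2 := ler_wpM2r eta0 ugg.
  have ggg0 : 0 <= g * g * g * eta by rewrite !mulr_ge0.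
  have h3 := ler_wpM2r ggg0 H2.
  apply: (@le_trans _ _ (g * eta + u * (g * g) * eta)).
    by rewrite le_eqVlt; apply/orP; left; apply/eqP; ring.
  by lra.
exists Q, (Q + (- e)%:P), (fun h => 0 <= s h - Q.[h%:R]); split=> //.
- exact: size_cst.
- apply: leq_trans (changes_iter_sdiff m _ _) _.
  rewrite (_ : changes _ H = 0%N) ?add0n -?addnn ?leq_addr //.
  rewrite /changes big1 // => i _.
  by rewrite !iter_sdiffB !iter_sdiff_horner // !subr0 !(sP _).1 eqxx.
- move=> h hH; have [z qz] := qQ h.
  have rho : `|s h - Q.[h%:R]| <= e.
    rewrite -(subrK P.[h%:R] (s h)) -addrA.
    by apply: (le_trans (ler_normD _ _)); rewrite lerD ?Perr ?PQ.
  have := floor_near_rational _ _ _ _ _ q0 qz rho qe.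
  by rewrite addrC subrK hornerD hornerC.
Qed.

(** * Counting the words *)

(** With r >= 1 the square root of [H], H + 2 <= (1 + 2r)^2 <= exp(2r)^2; the added 1 keeps the
    constant positive for [K = 0]. *)
Lemma pow_leq_expR {R : realType} (H K : nat) : (0 < H)%N ->
  (H.+2 ^ K)%:R <= expR ((4 * K).+1%:R * (H%:R `^ 2^-1)) :> R.
Proof.
move=> H0; rewrite powR12_sqrt //; set r := Num.sqrt _.
have r1 : 1 <= r by rewrite -[1]sqrtr1 ler_wsqrtr // ler1n.
have r2 : r ^+ 2 = H%:R by rewrite sqr_sqrtr.
have step : H.+2%:R <= expR (4 * r).
  have e2 := expR_ge1Dx (2 * r).
  apply: (@le_trans _ _ ((1 + 2 * r) ^+ 2)).
    by rewrite -natr1 -natr1 -r2; nra.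
  rewrite (_ : 4 * r = (2 * r) * 2%:R); last by ring.
  rewrite expRM_natr.
  by apply: lerXn2r => //; rewrite nnegrE; lra.
rewrite natrX; apply: (@le_trans _ _ (expR (4 * r) ^+ K)).
  by apply: lerXn2r => //; rewrite nnegrE ?expR_ge0.
rewrite -expRM_natr ler_expR.
have -> : (4 * K).+1%:R = 4 * K%:R + 1 :> R by rewrite -natr1 natrM.
by rewrite -subr_ge0 (_ : _ - _ = r); [lra|ring].
Qed.

Lemma covered_card {T : finType} (n : nat) (A : {pred T}) :
  covered n (fun x => x \in A) -> (#|A| <= n)%N.
Proof.
move=> [s [sn sA]]; apply: leq_trans sn; apply: leq_trans (card_size s).
by apply/subset_leq_card/fintype.subsetP => x /sA.
Qed.

Lemma covered_subwords {R : realType} {Sigma : finType} (a : int -> Sigma)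
    (f : R -> R) :
  bracket_word (R := R) a -> hardy_function f -> poly_growth f ->
  exists K, forall H, covered (H.+2 ^ K) (fun w : {ffun 'I_H -> Sigma} =>
    exists N : nat, forall h : 'I_H, w h = a (Num.floor (f (N + h)%:R))).
Proof.
move=> ba hf pf.
have [m [b [C [n0 [m0 df]]]]] := hardy_differences f hf pf.
have [K cK] := covered_poly_words a m ba.
(* This makes [M] exceed [n0] and [C] times the power required by [floor_two_polys] with [eta] =
   C/M. The words with starting point below [M] are counted one by one. *)
pose B := (m * m + 3 * m + 2 + C + n0)%N.
(* The last 1 absorbs the sum of the two counts, x + y <= 2xy. *)
exists (B.+1 + (K + K + m.*2.+1) + 1)%N => H.
pose M := (H.+2 ^ B.+1)%N.
pose word N : {ffun 'I_H -> Sigma} := [ffun h : 'I_H => a (Num.floor (f (N + h)%:R))].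
have cP := covered_pair (covered_pair (cK H) (cK H)) (covered_changes H m.*2).
pose mix (z : {ffun 'I_H -> Sigma} * {ffun 'I_H -> Sigma} * {ffun 'I_H -> bool}) :
  {ffun 'I_H -> Sigma} := [ffun h => if z.2 h then z.1.1 h else z.1.2 h].
have c1 : covered M (fun w => exists2 N, (N < M)%N & w = word N).
  exact: (covered_image word _ (covered_ltn M)).
have c2 := covered_image mix (fun w => exists2 z, _ & w = mix z) cP (fun w P => P).
apply: (covered_weaken _ _ (coveredU c1 c2)).
  rewrite -!expnD /M [leqRHS]expnD expn1.
  set x := (H.+2 ^ B.+1)%N; set y := (H.+2 ^ (K + K + m.*2.+1))%N.
  have x0 : (0 < x)%N by rewrite expn_gt0.
  have y0 : (0 < y)%N by rewrite expn_gt0.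
  rewrite expnD -/x -/y.
  apply: (@leq_trans (x * y * 2)); last by rewrite leq_mul.
  by rewrite muln2 -addnn leq_add // ?leq_pmulr ?leq_pmull.
move=> w [N wN]; have wE : w = word N by apply/ffunP => h; rewrite ffunE wN.
have [NM|MN] := ltnP N M; [by left; exists N|right].
have M0 : 0 < M%:R :> R by rewrite ltr0n expn_gt0.
have [||j||P1 [P2 [T [sP1 sP2 cT sE]]]] :=
  @floor_two_polys R m H b (fun h => f (N + h)%:R) (C%:R / M%:R).
- by rewrite divr_ge0.
- exact: m0.
- rewrite iter_sdiff; apply: df.
    rewrite /M expnS; apply: (@leq_trans (2 * n0.+1)); first by lia.
    rewrite leq_mul //; apply: leq_trans (_ : H.+2 ^ n0 <= _)%N.
      by rewrite ltn_expl.
    by rewrite leq_pexp2l // leq_addl.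
  exact: leq_trans MN (leq_addr _ _).
- rewrite mulrA -natrM ltr_pdivrMr // mul1r ltr_nat.
  apply: (@leq_trans (H.+2 ^ (m * m + 3 * m + 2) * H.+2 ^ C)).
    by rewrite ltn_pmul2l ?expn_gt0 // ltn_expl.
  rewrite -expnD leq_pexp2l // /B; lia.
exists ([ffun h : 'I_H => a (Num.floor P1.[h%:R])],
  [ffun h : 'I_H => a (Num.floor P2.[h%:R])], [ffun h : 'I_H => T h]).
  split=> /=; last by exists T => // h; rewrite ffunE.
  by split; [exists P1|exists P2] => // h; rewrite ffunE.
apply/ffunP => h; rewrite wN /mix !ffunE /= sE //.
by case: (T h).
Qed.

Theorem theoremA (R : realType) (Sigma : finType) (a : int -> Sigma)
    (f : R -> R) :
  bracket_word (R := R) a -> hardy_function f -> poly_growth f ->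
  exists delta C : R, [/\ 0 < delta, delta < 1, 0 < C &
    forall H : nat, (0 < H)%N ->
      (subword_complexity a f H)%:R <= expR (C * (H%:R `^ delta))].
Proof.
move=> ba hf pf; have [K cK] := covered_subwords a f ba hf pf.
exists 2^-1, (4 * K).+1%:R; split; [lra|lra|by rewrite ltr0n|].
move=> H H0; apply: le_trans (pow_leq_expR H K H0); rewrite ler_nat.
rewrite /subword_complexity; apply: covered_card; have /covered_weaken := cK H; apply=> // w.
by rewrite inE /= => /asboolP.
Qed.
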